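(* Let $p$ be any prime number, let $R=\mathbb{F}_p[T]/(T^2)$, and let $t=T+(T^2)\in R$. Then $\mathrm{SA}_2(R)\not\subseteq \mathrm{TA}_2(R)$. More precisely, the automorphism $$(X+tX^pY^{p-1},\,Y)$$ of $R[X,Y]$ is an element of $\mathrm{SA}_2(R)$ that is not tame, i.e. it does not belong to $\mathrm{TA}_2(R)$.
   Context: All rings are commutative with identity. For a ring $R$, a polynomial map over $R$ is an ordered pair $(F,G)$ of polynomials in $R[X,Y]$; composition is $(F_1,G_1)\circ(F_2,G_2)=(F_1(F_2,G_2),G_1(F_2,G_2))$, and the identity is $(X,Y)$. $\mathrm{GA}_2(R)$ is the group (under composition) of invertible polynomial maps, called automorphisms. For $\varphi\in\mathrm{GA}_2(R)$, $|\mathrm{J}\varphi|$ is the determinant of its Jacobian matrix with respect to $X,Y$. $\mathrm{SA}_2(R)$ is the subgroup of all $\varphi\in\mathrm{GA}_2(R)$ with $|\mathrm{J}\varphi|=1$. The group $\mathrm{GL}_2(R)$ of invertible $2\times 2$ matrices is viewed as the subgroup of $\mathrm{GA}_2(R)$ of linear automorphisms $(aX+bY,cX+dY)$. $\mathrm{EA}_2(R)$ is the subgroup of $\mathrm{GA}_2(R)$ generated by the elementary automorphisms, i.e. those of the form $(X+f(Y),Y)$ or $(X,Y+f(X))$ with $f$ a univariate polynomial over $R$. $\mathrm{TA}_2(R)$, the group of tame automorphisms, is the subgroup of $\mathrm{GA}_2(R)$ generated by $\mathrm{GL}_2(R)$ and $\mathrm{EA}_2(R)$. *)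

(* Defs.v *)
From HB Require Import structures.
From mathcomp Require Import all_boot all_order all_algebra.
From mathcomp Require Import mpoly.

Set Implicit Arguments.
Unset Strict Implicit.
Unset Printing Implicit Defensive.

Import GRing.Theory.
Local Open Scope ring_scope.

Section PolynomialMaps.
Variable R : comUnitRingType.

Definition polymap : Type := ({mpoly R[2]} * {mpoly R[2]})%type.

Definition varX : {mpoly R[2]} := 'X_ord0.
Definition varY : {mpoly R[2]} := 'X_ord_max.

Implicit Types (phi psi : polymap) (S : polymap -> Prop).

Definition components phi : 2.-tuple {mpoly R[2]} := [tuple phi.1; phi.2].

Definition pmcomp phi psi : polymap :=
  (phi.1 \mPo components psi, phi.2 \mPo components psi).

Definition pmid : polymap := (varX, varY).

Definition pminverse phi psi : Prop :=
  pmcomp phi psi = pmid /\ pmcomp psi phi = pmid.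

Definition GA2 phi : Prop := exists psi, pminverse phi psi.

Definition Jacobian phi : 'M[{mpoly R[2]}]_2 :=
  \matrix_(i, j) mderiv j (tnth (components phi) i).

Definition SA2 phi : Prop := GA2 phi /\ \det (Jacobian phi) = 1.

(* The subgroup of [GA2] generated by [S]; meant for [S] contained in [GA2]. *)
Inductive generated S : polymap -> Prop :=
| generated_id : generated S pmid
| generated_in phi : S phi -> generated S phi
| generated_comp phi psi :
    generated S phi -> generated S psi -> generated S (pmcomp phi psi)
| generated_inv phi psi :
    generated S phi -> pminverse phi psi -> generated S psi.

Definition linear_map (A : 'M[R]_2) : polymap :=
  (A ord0 ord0 *: varX + A ord0 ord_max *: varY,
   A ord_max ord0 *: varX + A ord_max ord_max *: varY).

Definition GL2 phi : Prop := exists2 A, A \in unitmx & phi = linear_map A.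

(* [horner_alg u f] is the value f(u) of f : {poly R} at u : {mpoly R[2]}. *)
Definition elementary phi : Prop :=
  exists f : {poly R}, phi = (varX + horner_alg varY f, varY)
                    \/ phi = (varX, varY + horner_alg varX f).

Definition EA2 : polymap -> Prop := generated elementary.

Definition TA2 : polymap -> Prop :=
  generated (fun phi => GL2 phi \/ EA2 phi).

End PolynomialMaps.

Arguments varX {R}.
Arguments varY {R}.

(* Main.v *)
Require Import Defs.
From mathcomp Require Import all_boot all_order all_algebra.
From mathcomp Require Import mpoly.
From mathcomp Require Import ring.

(** Work with polynomial 1-forms [a dX + b dY] over R and with
    [theta = X dY] ([liouville]).  A tame map pulls [theta] back to a unit
    multiple of itself plus a form that is a combination of exact forms and
    of forms [u^k du]: for [(X + f(Y), Y)] the extra term is [f(Y) dY], for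
    [(X, Y + f(X))] it is [X f'(X) dX], and a linear map of determinant
    [delta] gives [delta theta] plus multiples of [d(XY)], [X dX], [Y dY].
    Both kinds of term survive pullback, so the property passes to
    composites and inverses, hence to all of TA_2(R) ([semi_invariant_tame]).

    The non-tame map pulls [theta] back to [theta + t X^p Y^(p-1) dY].  In
    characteristic p, [X^p Y^(p-1) dY] is closed, and the Cartier operator
    sends it to [X dY], which is not closed, whereas it sends the closed
    forms [u^k du] to closed forms.  What tells them apart is the constant
    coefficient of d C(w).  It has the explicit formula [residue p w], the
    coefficient of [X^p Y^p] in the contraction of [w] with the vector field
    [Y d/dY - X d/dX], and this makes sense over every commutative ring.
    That field multiplies a monomial [X^i Y^j] by [j - i], so residues of
    exact forms vanish.  As [(k+1) u^k du = d(u^(k+1))], residues of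
    [u^k du] vanish over a ring without torsion, and therefore over every
    ring by lifting the coefficients of u ([residue_power]).

    So the residue of [theta] pulled back by a tame map is a multiple of the
    residue of [theta], that is zero as soon as p > 1, while the pullback
    by the map in question has residue t. *)

Import GRing.Theory.
Local Open Scope ring_scope.
Set Implicit Arguments.
Unset Strict Implicit.
Unset Printing Implicit Defensive.

Lemma det_mx2 (R : comNzRingType) (A : 'M[R]_2) :
  \det A = A ord0 ord0 * A ord_max ord_max - A ord0 ord_max * A ord_max ord0.
Proof.
rewrite (expand_det_row _ ord0) !big_ord_recl big_ord0 /cofactor.
rewrite !det_mx11 !mxE /= addr0 expr0 mul1r expr1 mulN1r mulrN.
have -> : lift ord0 0 = ord_max :> 'I_2 by apply: val_inj.
by have -> : lift ord_max 0 = ord0 :> 'I_2 by apply: val_inj.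
Qed.

Lemma mnm_sub1 n (i : 'I_n) : (U_(i) - U_(i))%MM = 0%MM.
Proof. by apply/mnmP => j; rewrite mnmE subnn mnm0E. Qed.

Lemma horner_alg_sum (R : comNzRingType) (A : comAlgType R) (u : A) (f : {poly R}) :
  horner_alg u f = \sum_(i < size f) f`_i *: u ^+ i.
Proof.
rewrite -{1}[f]coefK poly_def raddf_sum; apply: eq_bigr => i _.
by rewrite -mul_polyC [LHS]rmorphM rmorphXn /= horner_algC horner_algX mulr_algl.
Qed.

(** * Polynomial 1-forms in two variables and their residues *)

(** The pair (a, b) stands for the 1-form [a dX + b dY]. *)
Notation form R := ({mpoly R[2]} * {mpoly R[2]})%type.

Section Forms.
Variable R : comNzRingType.
Implicit Types (u v : {mpoly R[2]}) (w : form R).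

Definition diff u : form R := (mderiv ord0 u, mderiv ord_max u).

Definition fmul u w : form R := (u * w.1, u * w.2).

(** Contraction with the vector field [Y d/dY - X d/dX]. *)
Definition euler w : {mpoly R[2]} := 'X_ord_max * w.2 - 'X_ord0 * w.1.

(** For a closed form over a perfect field of characteristic n = p, this is
    the p-th power of the constant coefficient of d C(w), C being the Cartier
    operator. *)
Definition residue (n : nat) w : R := (euler w)@_[multinom n | _ < 2].

Lemma form_eq w1 w2 : w1.1 = w2.1 -> w1.2 = w2.2 -> w1 = w2.
Proof. by case: w1 w2 => [a b] [c d] /= -> ->. Qed.

Lemma diffD u v : diff (u + v) = diff u + diff v.
Proof. by rewrite /diff !mderivD. Qed.

Lemma diffZ (c : R) u : diff (c *: u) = c *: diff u.
Proof. by rewrite /diff !mderivZ. Qed.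

Lemma diffM u v : diff (u * v) = fmul u (diff v) + fmul v (diff u).
Proof.
rewrite /diff !mderivM; apply: form_eq => /=; ring.
Qed.

Lemma fmulA u v w : fmul u (fmul v w) = fmul (u * v) w.
Proof. by rewrite /fmul !mulrA. Qed.

Lemma fmulMn u w k : fmul u (w *+ k) = fmul u w *+ k.
Proof.
elim: k => [|k IHk]; first by rewrite !mulr0n /fmul /= !mulr0.
by rewrite !mulrS -IHk; apply: form_eq => /=; ring.
Qed.

Lemma fmul_suml (I : Type) (r : seq I) (F : I -> {mpoly R[2]}) w :
  fmul (\sum_(i <- r) F i) w = \sum_(i <- r) fmul (F i) w.
Proof.
elim/big_rec2: _ => [|i v1 v2 _ <-]; first by rewrite /fmul !mul0r.
by rewrite /fmul !mulrDl.
Qed.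

Lemma fmul_sumr (I : Type) (r : seq I) u (F : I -> form R) :
  fmul u (\sum_(i <- r) F i) = \sum_(i <- r) fmul u (F i).
Proof.
elim/big_rec2: _ => [|i v1 v2 _ <-]; first by rewrite /fmul !mulr0.
by rewrite /fmul !mulrDr.
Qed.

Lemma fmulZl (c : R) u w : fmul (c *: u) w = c *: fmul u w.
Proof. by rewrite /fmul -!scalerAl. Qed.

Lemma fmulZr (c : R) u w : fmul u (c *: w) = c *: fmul u w.
Proof. by rewrite /fmul -!scalerAr. Qed.

Lemma fmulDl u v w : fmul (u + v) w = fmul u w + fmul v w.
Proof. by rewrite /fmul !mulrDl. Qed.

Lemma fmulDr u w1 w2 : fmul u (w1 + w2) = fmul u w1 + fmul u w2.
Proof. by rewrite /fmul !mulrDr. Qed.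

Lemma diff_sum (I : Type) (r : seq I) (F : I -> {mpoly R[2]}) :
  diff (\sum_(i <- r) F i) = \sum_(i <- r) diff (F i).
Proof.
elim/big_rec2: _ => [|i v1 v2 _ <-]; last by rewrite diffD.
by rewrite /diff !mderiv0.
Qed.

Lemma diffXn u k : diff (u ^+ k.+1) = fmul (u ^+ k) (diff u) *+ k.+1.
Proof.
elim: k => [|k IHk]; first by rewrite expr1 expr0 /fmul !mul1r.
rewrite exprS diffM IHk [RHS]mulrSr; congr (_ + _).
rewrite fmulMn; congr (_ *+ _).
by rewrite /fmul exprS; apply: form_eq => /=; ring.
Qed.

Lemma eulerD w1 w2 : euler (w1 + w2) = euler w1 + euler w2.
Proof. by rewrite /euler /=; ring. Qed.

Lemma eulerZ (c : R) w : euler (c *: w) = c *: euler w.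
Proof. by rewrite /euler /= scalerBr !scalerAr. Qed.

Lemma residueD n w1 w2 : residue n (w1 + w2) = residue n w1 + residue n w2.
Proof. by rewrite /residue eulerD mcoeffD. Qed.

Lemma residueZ n (c : R) w : residue n (c *: w) = c * residue n w.
Proof. by rewrite /residue eulerZ mcoeffZ. Qed.

Lemma residueMn n w k : residue n (w *+ k) = residue n w *+ k.
Proof.
elim: k => [|k IHk]; last by rewrite !mulrS residueD IHk.
by rewrite !mulr0n /residue /euler /= !mulr0 subr0 mcoeff0.
Qed.

Lemma mulX_mderiv (i : 'I_2) (m : 'X_{1..2}) :
  'X_i * mderiv i 'X_[R, m] = (m i)%:R *: 'X_[R, m].
Proof.
rewrite mderivX -scalerAr -mpolyXD.
have [->|mi_gt0] := posnP (m i); first by rewrite !scale0r.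
rewrite addmC submK //; apply/mnm_lepP => j; rewrite mnm1E.
by case: eqP => // <-.
Qed.

(** [Y d/dY - X d/dX] has eigenvalue [j - i] on the monomial [X^i Y^j], hence
    kills the diagonal monomials and never produces them. *)
Lemma residue_diff n u : residue n (diff u) = 0.
Proof.
elim/mpolyind: u => [|c m u _ _ IHu].
  by rewrite /residue /euler /= !mderiv0 !mulr0 subr0 mcoeff0.
rewrite diffD diffZ residueD residueZ IHu addr0.
rewrite /residue /euler /= !mulX_mderiv mcoeffB !mcoeffZ mcoeffX.
by have [->|_] := eqVneq m; rewrite ?mulr0 ?subrr ?mulr0 // !mnmE subrr mulr0.
Qed.

End Forms.

(** * Residues of the forms u^k du *)

Lemma residue_map (R S : comNzRingType) (f : {rmorphism R -> S}) n (w : form R) :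
  residue n (map_mpoly f w.1, map_mpoly f w.2) = f (residue n w).
Proof.
rewrite /residue -mcoeff_map_mpoly /euler rmorphB !rmorphM /=.
by rewrite !map_mpolyX.
Qed.

Lemma mderiv_map (R S : comNzRingType) (f : {rmorphism R -> S}) n (i : 'I_n)
    (u : {mpoly R[n]}) :
  mderiv i (map_mpoly f u) = map_mpoly f (mderiv i u).
Proof.
by apply/mpolyP => m; rewrite mcoeff_mderiv !mcoeff_map_mpoly mcoeff_mderiv raddfMn.
Qed.

(** The lift has one indeterminate for each coefficient of u. *)
Lemma lift_torsion_free (R : comNzRingType) (u : {mpoly R[2]}) :
  exists (N : nat) (f : {rmorphism {mpoly int[N]} -> R})
         (v : {mpoly {mpoly int[N]}[2]}), map_mpoly f v = u.
Proof.
pose s := msupp u.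
pose f : {mpoly int[size s]} -> R :=
  mmap (intmul 1) (fun i => u@_(nth 0%MM s i)).
exists (size s), f, (\sum_(i < size s) 'X_i *: 'X_[nth 0%MM s i]).
rewrite raddf_sum [RHS]mpolyE (big_nth 0%MM) big_mkord; apply: eq_bigr => i _.
by rewrite /= map_mpolyZ map_mpolyX /f /= mmapX mmap1U.
Qed.

Lemma residue_power_torsion_free (S : comNzRingType) n k (v : {mpoly S[2]}) :
    (forall x : S, x *+ k.+1 = 0 -> x = 0) ->
  residue n (fmul (v ^+ k) (diff v)) = 0.
Proof. by apply; rewrite -residueMn -diffXn residue_diff. Qed.

Lemma residue_power_map (R S : comNzRingType) (f : {rmorphism S -> R}) n k
    (v : {mpoly S[2]}) :
  residue n (fmul (map_mpoly f v ^+ k) (diff (map_mpoly f v)))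
  = f (residue n (fmul (v ^+ k) (diff v))).
Proof.
rewrite -residue_map /fmul /diff /= !mderiv_map.
by congr (residue _ (_, _)); rewrite [RHS]rmorphM rmorphXn.
Qed.

(** When [k+1] is not invertible, [u^k du] need not be exact, as the example
    [u^(p-1) du] shows; the identity [(k+1) u^k du = d(u^(k+1))] is therefore
    used over a torsion-free ring that maps onto the coefficients of u. *)
Lemma residue_power (R : comNzRingType) n k (u : {mpoly R[2]}) :
  residue n (fmul (u ^+ k) (diff u)) = 0.
Proof.
have [N [f [v <-]]] := @lift_torsion_free R u.
rewrite residue_power_map residue_power_torsion_free ?rmorph0 // => x xk0.
apply/mpolyP => m; apply/eqP; have := congr1 (mcoeff m) xk0.
by rewrite mcoeffMn mcoeff0 => /eqP; rewrite Num.Theory.mulrn_eq0.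
Qed.

(** * Pullback of forms along polynomial maps *)

Section Pullback.
Variable R : comUnitRingType.
Implicit Types (u v : {mpoly R[2]}) (w : form R) (phi psi : polymap R).

Lemma comp_varX phi : varX \mPo components phi = phi.1.
Proof. by rewrite /varX comp_mpolyXU. Qed.

Lemma comp_varY phi : varY \mPo components phi = phi.2.
Proof. by rewrite /varY comp_mpolyXU. Qed.

Lemma diff_varX : diff varX = (1, 0) :> form R.
Proof. by rewrite /diff !mderivX !mnm1E /= mnm_sub1 mpolyX0 scale0r scale1r. Qed.

Lemma diff_varY : diff varY = (0, 1) :> form R.
Proof. by rewrite /diff !mderivX !mnm1E /= mnm_sub1 mpolyX0 scale0r scale1r. Qed.

Definition pullback phi w : form R :=
  fmul (w.1 \mPo components phi) (diff phi.1)
  + fmul (w.2 \mPo components phi) (diff phi.2).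

Lemma pullbackD phi w1 w2 :
  pullback phi (w1 + w2) = pullback phi w1 + pullback phi w2.
Proof. by rewrite /pullback /fmul /= !comp_mpolyD; apply: form_eq => /=; ring. Qed.

Lemma pullbackZ phi c w : pullback phi (c *: w) = c *: pullback phi w.
Proof.
rewrite /pullback /fmul /= !comp_mpolyZ -!mul_mpolyC; apply: form_eq => /=;
rewrite -!mul_mpolyC; ring.
Qed.

Lemma pullback_fmul phi u w :
  pullback phi (fmul u w) = fmul (u \mPo components phi) (pullback phi w).
Proof. by rewrite /pullback /fmul /= !rmorphM; apply: form_eq => /=; ring. Qed.

(** The chain rule.  As functions of u, both sides are R-linear derivations
    along the ring morphism [u |-> u o phi], so it is enough to compare them on
    the variables. *)
Lemma pullback_diff phi u :
  pullback phi (diff u) = diff (u \mPo components phi).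
Proof.
pose P u := pullback phi (diff u) = diff (u \mPo components phi).
have PM v1 v2 : P v1 -> P v2 -> P (v1 * v2).
  rewrite /P => P1 P2; rewrite rmorphM !diffM pullbackD !pullback_fmul.
  by rewrite P1 P2.
have P1 : P 1.
  rewrite /P rmorph1 /pullback /diff -!mpolyC1 !mderivC !rmorph0.
  by rewrite /fmul !mul0r addr0.
rewrite -/(P u); elim/mpolyind: u => [|c m u _ _].
  by rewrite /P rmorph0 /pullback /diff !mderiv0 !rmorph0 /fmul !mul0r addr0.
rewrite /P comp_mpolyD comp_mpolyZ !diffD !diffZ pullbackD pullbackZ => ->.
congr (_ *: _ + _); rewrite -/(P 'X_[m]) mpolyXE_id.
elim/big_ind: _ => // i _; elim: (m i) => [|k IHk]; rewrite ?expr0 ?exprS //.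
apply: PM => // {k IHk}; rewrite /P comp_mpolyXU.
case: i => [[|[|//]] lti].
  rewrite (_ : Ordinal lti = ord0); last exact: val_inj.
  rewrite [diff _]diff_varX /pullback /fmul /= rmorph0 rmorph1.
  by rewrite !mul1r !mul0r addr0.
rewrite (_ : Ordinal lti = ord_max); last exact: val_inj.
rewrite [diff _]diff_varY /pullback /fmul /= rmorph0 rmorph1.
by rewrite !mul1r !mul0r add0r.
Qed.

Lemma comp_mpoly_pmcomp phi psi u :
  (u \mPo components phi) \mPo components psi
  = u \mPo components (pmcomp phi psi).
Proof.
elim/mpolyind: u => [|c m u _ _ IHu]; first by rewrite !rmorph0.
rewrite !comp_mpolyD !comp_mpolyZ IHu; congr (_ *: _ + _).
rewrite !comp_mpolyX rmorph_prod; apply: eq_bigr => i _; rewrite rmorphXn.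
by congr (_ ^+ _); case: i => [[|[|//]] lti]; rewrite !(tnth_nth 0).
Qed.

Lemma pullback_comp phi psi w :
  pullback (pmcomp phi psi) w = pullback psi (pullback phi w).
Proof.
rewrite [pullback phi w]/pullback pullbackD !pullback_fmul !pullback_diff.
by rewrite !comp_mpoly_pmcomp.
Qed.

Lemma pullback_id w : pullback (pmid R) w = w.
Proof.
have idE u : u \mPo components (pmid R) = u.
  rewrite -[RHS]comp_mpoly_id; congr (_ \mPo _).
  apply: eq_from_tnth => -[[|[|//]] lti]; rewrite tnth_mktuple (tnth_nth 0) /=.
    by rewrite /varX; congr 'X_[U_(_)]; apply: val_inj.
  by rewrite /varY; congr 'X_[U_(_)]; apply: val_inj.
case: w => a b; rewrite /pullback /= !idE diff_varX diff_varY.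
by apply: form_eq => /=; ring.
Qed.

(** * Forms all of whose pullbacks have zero residue *)

(** Quantifying over all pullbacks makes the set stable under pullback by
    construction; over a perfect field of characteristic n it contains the
    closed forms whose image under the Cartier operator is closed. *)
Definition residue_free n w := forall psi, residue n (pullback psi w) = 0.

Lemma residue_free0 n : residue_free n 0.
Proof. by move=> psi; rewrite -(scale0r 0) pullbackZ residueZ mul0r. Qed.

Lemma residue_freeD n w1 w2 :
  residue_free n w1 -> residue_free n w2 -> residue_free n (w1 + w2).
Proof. by move=> w1N w2N psi; rewrite pullbackD residueD w1N w2N addr0. Qed.

Lemma residue_freeZ n c w : residue_free n w -> residue_free n (c *: w).
Proof. by move=> wN psi; rewrite pullbackZ residueZ wN mulr0. Qed.

Lemma residue_free_sum n (I : Type) (r : seq I) (F : I -> form R) :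
  (forall i, residue_free n (F i)) -> residue_free n (\sum_(i <- r) F i).
Proof.
move=> FN; elim/big_ind: _ => [|w1 w2 w1N w2N|i _].
- exact: residue_free0.
- exact: residue_freeD.
- exact: FN.
Qed.

Lemma residue_free_pullback n phi w :
  residue_free n w -> residue_free n (pullback phi w).
Proof. by move=> wN psi; rewrite -pullback_comp. Qed.

Lemma residue_free_power n k u : residue_free n (fmul (u ^+ k) (diff u)).
Proof.
by move=> psi; rewrite pullback_fmul pullback_diff rmorphXn residue_power.
Qed.

Lemma residue_free_diff n u : residue_free n (diff u).
Proof.
have <- : fmul (u ^+ 0) (diff u) = diff u by rewrite /fmul expr0 !mul1r.
exact: residue_free_power.
Qed.

(** * Tame maps and the form X dY *)

Definition liouville : form R := fmul varX (diff varY).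

(** Invariance of [X dY] up to a unit and modulo residue-free forms.  The
    factor has to be a unit for inverses to have the property again. *)
Definition semi_invariant n phi :=
  exists delta w, [/\ delta \is a GRing.unit, residue_free n w
                   & pullback phi liouville = delta *: liouville + w].

Lemma pullback_liouville phi : pullback phi liouville = fmul phi.1 (diff phi.2).
Proof. by rewrite pullback_fmul pullback_diff comp_varX comp_varY. Qed.

(** [(aX + bY) d(cX + dY) = (ad - bc) X dY + bc d(XY) + ac X dX + bd Y dY]. *)
Lemma semi_invariant_linear n A : A \in unitmx -> semi_invariant n (linear_map A).
Proof.
rewrite unitmxE det_mx2.
set a := A ord0 ord0; set b := A ord0 ord_max.
set c := A ord_max ord0; set d := A ord_max ord_max.
move=> uA; exists (a * d - b * c), ((b * c) *: diff (varX * varY)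
  + ((a * c) *: fmul (varX ^+ 1) (diff varX)
  + (b * d) *: fmul (varY ^+ 1) (diff varY))); split=> //.
  apply: residue_freeD; first exact/residue_freeZ/residue_free_diff.
  by apply: residue_freeD; apply/residue_freeZ/residue_free_power.
rewrite pullback_liouville /= -/a -/b -/c -/d diffD !diffZ diffM /liouville.
apply: form_eq; rewrite /fmul /= -!mul_mpolyC ?mpolyCB ?mpolyCM; ring.
Qed.

Lemma semi_invariant_elementary n phi : elementary phi -> semi_invariant n phi.
Proof.
case=> f [] ->.
  exists 1, (\sum_(i < size f) f`_i *: fmul (varY ^+ i) (diff varY)).
  split; [exact: unitr1 | |].
    by apply: residue_free_sum => i; apply/residue_freeZ/residue_free_power.
  rewrite pullback_liouville scale1r /= fmulDl horner_alg_sum fmul_suml.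
  by congr (_ + _); apply: eq_bigr => i _; rewrite fmulZl.
exists 1, (\sum_(i < size f) f`_i *: fmul varX (diff (varX ^+ i))).
split; [exact: unitr1 | |].
  apply: residue_free_sum => -[[|i] lti]; apply: residue_freeZ => /=.
    rewrite expr0 /fmul /diff -mpolyC1 !mderivC !mulr0; exact: residue_free0.
  (* [X d(X^(i+1))] is [i+1] times the power form [X^(i+1) dX]. *)
  rewrite diffXn fmulMn -scaler_nat; apply: residue_freeZ.
  rewrite fmulA -exprS; exact: residue_free_power.
rewrite pullback_liouville scale1r /= diffD fmulDr horner_alg_sum; congr (_ + _).
by rewrite diff_sum fmul_sumr; apply: eq_bigr => i _; rewrite diffZ fmulZr.
Qed.

Lemma semi_invariant_id n : semi_invariant n (pmid R).
Proof.
exists 1, 0; split; [exact: unitr1 | exact: residue_free0 |].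
by rewrite pullback_id scale1r addr0.
Qed.

Lemma semi_invariant_comp n phi psi :
    semi_invariant n phi -> semi_invariant n psi ->
  semi_invariant n (pmcomp phi psi).
Proof.
move=> [d [w [ud wN phiE]]] [e [v [ue vN psiE]]].
exists (d * e), (d *: v + pullback psi w); split; first by rewrite unitrM ud.
  by apply/residue_freeD/residue_free_pullback/wN/residue_freeZ.
by rewrite pullback_comp phiE pullbackD pullbackZ psiE scalerDr scalerA [RHS]addrA.
Qed.

(** Pulling [phi^* theta = d theta + w] back by psi gives
    [theta = d psi^* theta + psi^* w], to be solved for [psi^* theta]. *)
Lemma semi_invariant_inv n phi psi :
    semi_invariant n phi -> pminverse phi psi -> semi_invariant n psi.
Proof.
move=> [d [w [ud wN phiE]]] [phiK _].
exists d^-1, (- d^-1 *: pullback psi w); split; first by rewrite unitrV.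
  exact/residue_freeZ/residue_free_pullback.
have := pullback_id liouville; rewrite -phiK pullback_comp phiE pullbackD pullbackZ.
move=> {2}<-; rewrite scalerDr scalerA mulVr // scale1r -addrA -scalerDl.
by rewrite subrr scale0r addr0.
Qed.

Lemma semi_invariant_generated n (S : polymap R -> Prop) :
    (forall phi, S phi -> semi_invariant n phi) ->
  forall phi, generated S phi -> semi_invariant n phi.
Proof.
move=> SP phi; elim=> {phi} [|phi /SP|phi psi _ + _|phi psi _] //.
- exact: semi_invariant_id.
- exact: semi_invariant_comp.
- exact: semi_invariant_inv.
Qed.

Lemma semi_invariant_tame n phi : TA2 phi -> semi_invariant n phi.
Proof.
apply: semi_invariant_generated => {}phi [[A uA ->]|].
  exact: semi_invariant_linear.
by apply: semi_invariant_generated => {}phi; apply: semi_invariant_elementary.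
Qed.

(** * The maps (X + t X^n Y^m, Y) with t^2 = 0 *)

Lemma euler_dY u : euler (fmul u (diff varY)) = u * varY.
Proof. by rewrite /euler diff_varY /= mulr0 mulr0 subr0 mulr1 mulrC. Qed.

Lemma coeff_diagonal n i j :
  (varX ^+ i * varY ^+ j : {mpoly R[2]})@_[multinom n | _ < 2]
  = ((i == n) && (j == n))%:R.
Proof.
rewrite /varX /varY !mpolyXn -mpolyXD mcoeffX; congr (_ _)%:R.
apply/eqP/andP => [/mnmP E|[/eqP -> /eqP ->]].
  have := E ord0; have := E ord_max.
  rewrite !mnmDE !mulmnE !mnm1E !mnmE /= !mul0n !mul1n add0n addn0 => -> ->.
  by rewrite eqxx.
apply/mnmP => -[[|[|//]] lti].
all: by rewrite mnmDE !mulmnE !mnm1E mnmE /= mul0n mul1n ?addn0.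
Qed.

Lemma residue_liouville n : (1 < n)%N -> residue n liouville = 0.
Proof.
rewrite /residue euler_dY -[varX]expr1 -[varY]expr1 coeff_diagonal.
by case: n => [|[|n]].
Qed.

Lemma residue_tame n phi : TA2 phi -> (1 < n)%N ->
  residue n (fmul phi.1 (diff phi.2)) = 0.
Proof.
move=> /(semi_invariant_tame n) [d [w [_ wN phiE]]] n_gt1.
have w0 : residue n w = 0 by rewrite -(pullback_id w).
rewrite -pullback_liouville phiE residueD w0 addr0 residueZ.
by rewrite residue_liouville ?mulr0.
Qed.

Definition shear (t : R) n m : polymap R :=
  (varX + t *: (varX ^+ n * varY ^+ m), varY).

Lemma shear_not_tame t n : (1 < n)%N -> t != 0 -> ~ TA2 (shear t n n.-1).
Proof.
move=> n_gt1 /eqP t0 /residue_tame => /(_ n n_gt1) /=.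
rewrite fmulDl residueD residue_liouville // add0r fmulZl residueZ.
rewrite /residue euler_dY -mulrA -exprSr prednK ?(ltnW n_gt1) //.
by rewrite coeff_diagonal eqxx mulr1.
Qed.

Lemma shear_comp t n m :
  t ^+ 2 = 0 -> pmcomp (shear t n m) (shear (- t) n m) = pmid R.
Proof.
move=> t2; rewrite /pmcomp /shear /pmid /= comp_varY; congr (_, _).
rewrite comp_mpolyD comp_mpolyZ rmorphM !rmorphXn /= comp_varX comp_varY /=.
(* Modulo t the second map is the identity, so t X^n Y^m is left unchanged. *)
rewrite -addrA -[RHS]addr0; congr (_ + _).
rewrite scaleNr addrC -scalerBr -mulrBl subrXX.
by rewrite addrC addKr -scaleNr -!scalerAl scalerA mulrN -expr2 t2 oppr0 scale0r.
Qed.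

Lemma shear_SA2 t n m : t ^+ 2 = 0 -> n%:R = 0 :> R -> SA2 (shear t n m).
Proof.
move=> t2 n0; split.
  exists (shear (- t) n m); split; first exact: shear_comp.
  by rewrite -{2}(opprK t); apply: shear_comp; rewrite sqrrN.
rewrite det_mx2 !mxE !(tnth_nth 0) /= mderivD mderivZ mderivM.
rewrite /varX /varY !mpolyXn !mderivX !mulmnE !mnm1E /= mul1n mul0n n0.
rewrite !scale0r !scale1r mul0r mulr0 addr0 scaler0 addr0 mulr0 subr0.
by rewrite !mnm_sub1 mpolyX0 mulr1.
Qed.

End Pullback.

Theorem theorem5p1 (p : nat) (p_prime : prime p) :
  let R : comUnitRingType := {poly %/ ('X^2 : {poly 'F_p})} in
  let t : R := 'qX in
  let phi : polymap R := (varX + t *: (varX ^+ p * varY ^+ p.-1), varY) in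
  ~ (forall psi : polymap R, SA2 psi -> TA2 psi)
  /\ (SA2 phi /\ ~ TA2 phi).
Proof.
move=> R t phi.
have tE : t = 'X :> {poly 'F_p} by rewrite qpolyXE ?size_polyXn ?monicXn.
have t2 : t ^+ 2 = 0.
  apply: val_inj; rewrite [LHS]poly_of_qpolyX tE.
  by rewrite [X in Pdiv.Ring.rmodp _ X]mk_monic_Xn Pdiv.RingMonic.rmodpp ?monicXn.
have t_neq0 : t != 0.
  by apply/eqP => t0; have := tE; rewrite t0 => /esym/eqP; rewrite polyX_eq0.
have p0 : p%:R = 0 :> R.
  by have /pcharf0 : p \in [pchar R] by rewrite pchar_qpoly pchar_Fp.
have phiSA : SA2 phi by apply: shear_SA2.
have phiNT : ~ TA2 phi by apply: shear_not_tame => //; apply: prime_gt1.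
by split=> // sub; apply/phiNT/sub.
Qed.
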